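(* Let $\{z^k\}_{k\in\mathbb N}=\{(x^k,u^k,y^k)\}_{k\in\mathbb N}$ be a bounded Lagrangian sequence for problem (CM), and let $(\bar x,\bar u,\bar y)$ be a limit point (cluster point) of $\{z^k\}_{k\in\mathbb N}$. Then $\bar x$ is a critical point of (CM), i.e. $0\in\nabla f_0(\bar x)+\nabla F(\bar x)^T\partial h(F(\bar x))$.
   Context: Problem (CM): minimize $f(x)=f_0(x)+h(F(x))$ over $x\in\mathbb R^n$, where $f_0:\mathbb R^n\to\mathbb R$ and $F:\mathbb R^n\to\mathbb R^m$ ($m\le n$) are continuously differentiable, and $h:\mathbb R^m\to(-\infty,+\infty]$ is proper and lower semicontinuous with $\operatorname{dom}h=\{u:h(u)<\infty\}$ nonempty and closed. $\nabla F(x)\in\mathbb R^{m\times n}$ is the Jacobian; $\|\cdot\|$ is the Euclidean norm (operator norm for matrices). $\partial$ and $\partial^\infty$ denote the limiting and the horizon subdifferential (Rockafellar–Wets). The critical set of $f$ is $\operatorname{crit}f=\{x: 0\in\nabla f_0(x)+\nabla F(x)^T\partial h(F(x))\}$. Augmented Lagrangian: for $\rho>0$, $\mathcal L^\sharp_\rho(x,u,y)=f_0(x)+h(u)+\langle y,F(x)-u\rangle+\frac\rho2\|F(x)-u\|^2$ on $\mathbb R^n\times\mathbb R^m\times\mathbb R^m$. Lyapunov function: for $\beta>0$, $\mathcal E_\beta(x,u,y,w)=\mathcal L^\sharp_\rho(x,u,y)+\beta\|x-w\|^2$, $w\in\mathbb R^n$; $\mathcal E_{\beta_k}$ is built with $\rho=\rho_k$.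 Standing assumptions. (Well-posedness) $\inf_{x,u}\mathcal L^\sharp_\rho(x,u,y)>-\infty$ for every fixed $y\in\mathbb R^m$ (and $\rho>0$). (Assumption 1) For every $x$ with $F(x)\in\operatorname{dom}h$: $\nabla F(x)^Ty=0$ and $y\in\partial^\infty h(F(x))$ imply $y=0$. (Assumption 2) A set $\mathcal Z\subset\mathbb R^n$ (an information zone) is given, i.e. for some $\bar d\in(0,+\infty]$, $\mathcal Z\supset\{x:\operatorname{dist}(F(x),\operatorname{dom}h)\le\bar d\}\supset\{x:F(x)\in\operatorname{dom}h\}$, and: (i) there is $\gamma>0$ with $\|\nabla F(x)^Tv\|\ge\gamma\|v\|$ for all $x\in\mathcal Z$, $v\in\mathbb R^m$; (ii) $\nabla F$ is $L(F)$-Lipschitz on $\mathcal Z$; (iii) $\nabla f_0$ is $L(f_0)$-Lipschitz on $\mathcal Z$. Algorithm ALBUM. A Lagrangian algorithmic map $\mathcal A_\rho$ is a (set-valued) map $(x,u,y)\mapsto\mathcal A_\rho(x,u,y)\subset\mathbb R^n\times\mathbb R^m$ for which there are constants $a,b>0$ (the same for all penalty parameters $\rho$ used) such that every $(x^+,u^+)\in\mathcal A_\rho(x,u,y)$ satisfies $\frac a2\|x^+-x\|^2+\mathcal L^\sharp_\rho(x^+,u^+,y)\le\mathcal L^\sharp_\rho(x,u,y)$ and $\|\nabla_x\mathcal L^\sharp_\rho(x^+,u^+,y)\|\le b\|x^+-x\|$. Fix $\delta,\rho_0>0$, $\tau\in(0,\frac a2)$, any $(x^0,u^0,y^0)$ and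 any $x^{-1}\in\mathbb R^n$. For $k=0,1,\dots$: (1) $(x^{k+1},u^{k+1})\in\mathcal A_{\rho_k}(x^k,u^k,y^k)$; (2) $y^{k+1}=y^k+\rho_k(F(x^{k+1})-u^{k+1})$; (3) set $\beta_k=\frac{2b^2}{\rho_k\gamma^2}$; if $x^{k+1}\notin\mathcal Z$ or $\tau\|x^{k+1}-x^k\|^2>\mathcal E_{\beta_k}(x^k,u^k,y^k,x^{k-1})-\mathcal E_{\beta_k}(x^{k+1},u^{k+1},y^{k+1},x^k)$, set $\rho_{k+1}=\rho_k+\delta$; otherwise $\rho_{k+1}=\rho_k$. Lagrangian sequence: a sequence $z^k=(x^k,u^k,y^k)$ generated by ALBUM such that (C1) $\frac a2\|x^{k+1}-x^k\|^2+\mathcal L^\sharp_{\rho_k}(x^{k+1},u^{k+1},y^k)\le\mathcal L^\sharp_{\rho_k}(x^k,u^k,y^k)$ for all $k\ge0$; (C2) $\|\nabla_x\mathcal L^\sharp_{\rho_k}(x^{k+1},u^{k+1},y^k)\|\le b\|x^{k+1}-x^k\|$ for all $k\ge0$; (C3) there is $c>0$ such that for all $k\ge0$ some $v^{k+1}\in\partial_u\mathcal L^\sharp_{\rho_k}(x^{k+1},u^{k+1},y^k)$ satisfies $\|v^{k+1}\|\le c\|x^{k+1}-x^k\|$; (C4) whenever a subsequence $\{u^k\}_{k\in\mathcal K}$ converges to some $\bar u$, $\limsup_{k\in\mathcal K}h(u^k)\le h(\bar u)$. *)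

(* Defs.v *)
From HB Require Import structures.
From mathcomp Require Import all_boot all_order all_algebra.
From mathcomp Require Import all_classical all_reals all_analysis.

Set Implicit Arguments.
Unset Strict Implicit.
Unset Printing Implicit Defensive.

Import Order.TTheory GRing.Theory Num.Theory.
Import numFieldNormedType.Exports.

Local Open Scope classical_set_scope.
Local Open Scope ring_scope.

(* Points of R^n are row vectors 'rV[R]_n.  The library norm `|x| on 'rV[R]_n
   is the sup norm; it induces the usual topology, so limits, derivatives and
   boundedness are the library's, but every norm that occurs in an inequality
   is the Euclidean one, [enorm]. *)

Definition dot (R : realType) (n : nat) (u v : 'rV[R]_n) : R :=
  \sum_i u 0 i * v 0 i.

Definition enorm (R : realType) (n : nat) (u : 'rV[R]_n) : R :=
  Num.sqrt (dot u u).

(* The m x n matrix M acts on R^n by v |-> v *m M^T, i.e. v |-> M v on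
   columns. *)
Definition opnorm (R : realType) (m n : nat) (M : 'M[R]_(m, n)) : R :=
  sup [set enorm (v *m M^T) | v in [set v : 'rV[R]_n | enorm v <= 1]].

Definition dist_set (R : realType) (m : nat) (u : 'rV[R]_m)
    (A : set 'rV[R]_m) : R :=
  inf [set enorm (u - w) | w in A].

Definition grad (R : realType) (n : nat) (f : 'rV[R]_n -> R) (x : 'rV[R]_n) :
    'rV[R]_n :=
  \row_i 'D_(delta_mx 0 i) f x.

(* The library's [jacobian] satisfies 'd F x v = v *m jacobian F x, so the usual
   m x n Jacobian is its transpose.  For a row vector y, the product
   (nabla F x)^T y of column-vector notation is y *m nabla F x. *)
Definition nabla (R : realType) (n m : nat) (F : 'rV[R]_n -> 'rV[R]_m)
    (x : 'rV[R]_n) : 'M[R]_(m, n) :=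
  (jacobian F x)^T.

Definition dom (R : realType) (m : nat) (h : 'rV[R]_m -> \bar R) :
    set 'rV[R]_m :=
  [set u | (h u < +oo)%E].

(* h(w) >= h(u) + <v, w - u> + o(|w - u|) as w -> u, at a point where h is
   finite. *)
Definition regular_subdiff (R : realType) (m : nat) (h : 'rV[R]_m -> \bar R)
    (u : 'rV[R]_m) : set 'rV[R]_m :=
  [set v | h u \is a fin_num /\
    forall e : R, 0 < e ->
      \forall w \near u,
        (h u + (dot v (w - u) - e * enorm (w - u))%:E <= h w)%E].

Definition limiting_subdiff (R : realType) (m : nat) (h : 'rV[R]_m -> \bar R)
    (u : 'rV[R]_m) : set 'rV[R]_m :=
  [set v | h u \is a fin_num /\
    exists us vs : nat -> 'rV[R]_m,
      [/\ us @ \oo --> u,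
          (h \o us) @ \oo --> h u,
          forall k, regular_subdiff h (us k) (vs k)
        & vs @ \oo --> v]].

Definition horizon_subdiff (R : realType) (m : nat) (h : 'rV[R]_m -> \bar R)
    (u : 'rV[R]_m) : set 'rV[R]_m :=
  [set v | h u \is a fin_num /\
    exists (us vs : nat -> 'rV[R]_m) (l : nat -> R),
      [/\ us @ \oo --> u,
          (h \o us) @ \oo --> h u,
          forall k, regular_subdiff h (us k) (vs k),
          (forall k, 0 < l k) /\ l @ \oo --> (0 : R)
        & (fun k => l k *: vs k) @ \oo --> v]].

Definition crit (R : realType) (n m : nat) (f0 : 'rV[R]_n -> R)
    (F : 'rV[R]_n -> 'rV[R]_m) (h : 'rV[R]_m -> \bar R) : set 'rV[R]_n :=
  [set x | exists2 v, limiting_subdiff h (F x) v &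
             0 = grad f0 x + v *m nabla F x].

Definition lagrangian_smooth (R : realType) (n m : nat) (f0 : 'rV[R]_n -> R)
    (F : 'rV[R]_n -> 'rV[R]_m) (rho : R) (x : 'rV[R]_n) (u y : 'rV[R]_m) : R :=
  f0 x + dot y (F x - u) + rho / 2 * enorm (F x - u) ^+ 2.

Definition lagrangian (R : realType) (n m : nat) (f0 : 'rV[R]_n -> R)
    (F : 'rV[R]_n -> 'rV[R]_m) (h : 'rV[R]_m -> \bar R) (rho : R)
    (x : 'rV[R]_n) (u y : 'rV[R]_m) : \bar R :=
  ((lagrangian_smooth f0 F rho x u y)%:E + h u)%E.

(* The term h(u) does not depend on x, so the x-gradient of the augmented
   Lagrangian is that of its real-valued part. *)
Definition grad_x_lagrangian (R : realType) (n m : nat) (f0 : 'rV[R]_n -> R)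
    (F : 'rV[R]_n -> 'rV[R]_m) (rho : R) (x : 'rV[R]_n) (u y : 'rV[R]_m) :
    'rV[R]_n :=
  grad (fun x' => lagrangian_smooth f0 F rho x' u y) x.

Definition lyapunov (R : realType) (n m : nat) (f0 : 'rV[R]_n -> R)
    (F : 'rV[R]_n -> 'rV[R]_m) (h : 'rV[R]_m -> \bar R) (rho beta : R)
    (x : 'rV[R]_n) (u y : 'rV[R]_m) (w : 'rV[R]_n) : \bar R :=
  (lagrangian f0 F h rho x u y + (beta * enorm (x - w) ^+ 2)%:E)%E.

Definition well_posed (R : realType) (n m : nat) (f0 : 'rV[R]_n -> R)
    (F : 'rV[R]_n -> 'rV[R]_m) (h : 'rV[R]_m -> \bar R) : Prop :=
  forall (rho : R) (y : 'rV[R]_m), 0 < rho ->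
    (-oo < ereal_inf [set lagrangian f0 F h rho p.1 p.2 y
                     | p in [set: 'rV[R]_n * 'rV[R]_m]])%E.

Definition constraint_qualification (R : realType) (n m : nat)
    (F : 'rV[R]_n -> 'rV[R]_m) (h : 'rV[R]_m -> \bar R) : Prop :=
  forall x, dom h (F x) ->
    forall y, y *m nabla F x = 0 -> horizon_subdiff h (F x) y -> y = 0.

Definition information_zone (R : realType) (n m : nat)
    (F : 'rV[R]_n -> 'rV[R]_m) (h : 'rV[R]_m -> \bar R) (Z : set 'rV[R]_n) :
    Prop :=
  exists2 d : \bar R, (0 < d)%E &
    [set x | ((dist_set (F x) (dom h))%:E <= d)%E] `<=` Z /\
    [set x | dom h (F x)] `<=` [set x | ((dist_set (F x) (dom h))%:E <= d)%E].

Definition regular_on_zone (R : realType) (n m : nat) (f0 : 'rV[R]_n -> R)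
    (F : 'rV[R]_n -> 'rV[R]_m) (Z : set 'rV[R]_n) (gamma LF Lf0 : R) : Prop :=
  [/\ forall x v, Z x -> gamma * enorm v <= enorm (v *m nabla F x),
      forall x x', Z x -> Z x' ->
        opnorm (nabla F x - nabla F x') <= LF * enorm (x - x')
    & forall x x', Z x -> Z x' ->
        enorm (grad f0 x - grad f0 x') <= Lf0 * enorm (x - x')].

Definition lagrangian_map (R : realType) (n m : nat) (f0 : 'rV[R]_n -> R)
    (F : 'rV[R]_n -> 'rV[R]_m) (h : 'rV[R]_m -> \bar R) (a b rho : R)
    (A : 'rV[R]_n -> 'rV[R]_m -> 'rV[R]_m -> set ('rV[R]_n * 'rV[R]_m)) :
    Prop :=
  forall x u y xp up, A x u y (xp, up) ->
    ((a / 2 * enorm (xp - x) ^+ 2)%:E + lagrangian f0 F h rho xp up y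
       <= lagrangian f0 F h rho x u y)%E
    /\ enorm (grad_x_lagrangian f0 F rho xp up y) <= b * enorm (xp - x).

(* x^{k-1}, where xm1 is x^{-1}. *)
Definition prev (T : Type) (xm1 : T) (x : nat -> T) (k : nat) : T :=
  if k is k'.+1 then x k' else xm1.

Definition album (R : realType) (n m : nat) (f0 : 'rV[R]_n -> R)
    (F : 'rV[R]_n -> 'rV[R]_m) (h : 'rV[R]_m -> \bar R) (Z : set 'rV[R]_n)
    (gamma a b delta tau : R)
    (A : R -> 'rV[R]_n -> 'rV[R]_m -> 'rV[R]_m -> set ('rV[R]_n * 'rV[R]_m))
    (xm1 : 'rV[R]_n) (x : nat -> 'rV[R]_n) (u y : nat -> 'rV[R]_m)
    (rho : nat -> R) : Prop :=
  forall k,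
    let beta := 2 * b ^+ 2 / (rho k * gamma ^+ 2) in
    [/\ lagrangian_map f0 F h a b (rho k) (A (rho k)),
        A (rho k) (x k) (u k) (y k) (x k.+1, u k.+1),
        y k.+1 = y k + rho k *: (F (x k.+1) - u k.+1)
      & rho k.+1 =
        if (x k.+1 \notin Z)
           || (lyapunov f0 F h (rho k) beta (x k) (u k) (y k) (prev xm1 x k)
               - lyapunov f0 F h (rho k) beta (x k.+1) (u k.+1) (y k.+1) (x k)
               < (tau * enorm (x k.+1 - x k) ^+ 2)%:E)%E
        then rho k + delta else rho k].

Definition lagrangian_sequence (R : realType) (n m : nat) (f0 : 'rV[R]_n -> R)
    (F : 'rV[R]_n -> 'rV[R]_m) (h : 'rV[R]_m -> \bar R) (Z : set 'rV[R]_n)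
    (gamma a b delta tau : R)
    (A : R -> 'rV[R]_n -> 'rV[R]_m -> 'rV[R]_m -> set ('rV[R]_n * 'rV[R]_m))
    (xm1 : 'rV[R]_n) (x : nat -> 'rV[R]_n) (u y : nat -> 'rV[R]_m)
    (rho : nat -> R) : Prop :=
  [/\ album f0 F h Z gamma a b delta tau A xm1 x u y rho,
      forall k,
        ((a / 2 * enorm (x k.+1 - x k) ^+ 2)%:E
           + lagrangian f0 F h (rho k) (x k.+1) (u k.+1) (y k)
         <= lagrangian f0 F h (rho k) (x k) (u k) (y k))%E,
      forall k,
        enorm (grad_x_lagrangian f0 F (rho k) (x k.+1) (u k.+1) (y k))
        <= b * enorm (x k.+1 - x k),
      exists2 c : R, 0 < c & forall k,
        exists2 v : 'rV[R]_m,
          limiting_subdiff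
            (fun w => lagrangian f0 F h (rho k) (x k.+1) w (y k)) (u k.+1) v
          & enorm v <= c * enorm (x k.+1 - x k)
    & forall (phi : nat -> nat) (ubar : 'rV[R]_m),
        {homo phi : i j / (i < j)%N} ->
        (u \o phi) @ \oo --> ubar ->
        (limn_esup (h \o u \o phi) <= h ubar)%E].

(* Main.v *)
(* If the penalty were increased infinitely often it would tend to infinity;
   since the multipliers are bounded, F(x^k) - u^k would tend to 0, so the x^k
   would eventually lie in the information zone. There the uniform regularity of
   nabla F bounds each multiplier step by the last two primal steps, and for a
   large penalty the Lyapunov function then decreases enough to pass the
   acceptance test: a contradiction. Hence the penalty is eventually constant and
   the Lyapunov function is nonincreasing and bounded below, so the primal steps,
   the multiplier steps and F(x^k) - u^k all tend to 0. By (C3), y^k is within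
   o(1) of a limiting subgradient of h at u^k; (C4), lower semicontinuity and
   closedness of dom h give h(u^k) -> h(ubar) along a subsequence, so both
   optimality conditions pass to the limit. *)

Require Import Defs.
From HB Require Import structures.
From mathcomp Require Import all_boot all_order all_algebra.
From mathcomp Require Import all_classical all_reals all_analysis.
From mathcomp Require Import zify ring lra.

Import Order.TTheory GRing.Theory Num.Theory.
Import numFieldNormedType.Exports.

Local Open Scope classical_set_scope.
Local Open Scope ring_scope.

(** * Euclidean inner product and norm, and comparison with the sup norm *)

Section Euclidean.
Context {R : realType} {n : nat}.
Implicit Types (u v w : 'rV[R]_n) (c : R).

Lemma dotC u v : dot u v = dot v u.
Proof. by apply: eq_bigr => i _; rewrite mulrC. Qed.

Lemma dotDl u v w : dot (u + v) w = dot u w + dot v w.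
Proof. by rewrite /dot -big_split; apply: eq_bigr => i _; rewrite !mxE mulrDl. Qed.

Lemma dotZl c u v : dot (c *: u) v = c * dot u v.
Proof. by rewrite /dot mulr_sumr; apply: eq_bigr => i _; rewrite !mxE mulrA. Qed.

Lemma dotNl u v : dot (- u) v = - dot u v.
Proof. by rewrite -scaleN1r dotZl mulN1r. Qed.

Lemma dotBl u v w : dot (u - v) w = dot u w - dot v w.
Proof. by rewrite dotDl dotNl. Qed.

Lemma dotDr u v w : dot w (u + v) = dot w u + dot w v.
Proof. by rewrite dotC dotDl !(dotC w). Qed.

Lemma dotZr c u v : dot u (c *: v) = c * dot u v.
Proof. by rewrite dotC dotZl dotC. Qed.

Lemma dotBr u v w : dot w (u - v) = dot w u - dot w v.
Proof. by rewrite dotC dotBl !(dotC w). Qed.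

Lemma dot_ge0 u : 0 <= dot u u.
Proof. by apply: sumr_ge0 => i _; rewrite -expr2 sqr_ge0. Qed.

Lemma enorm_ge0 u : 0 <= enorm u.
Proof. exact: sqrtr_ge0. Qed.

Lemma sqr_enorm u : enorm u ^+ 2 = dot u u.
Proof. by rewrite sqr_sqrtr ?dot_ge0. Qed.

Lemma normr_coord_le_enorm u (i : 'I_n) : `|u 0 i| <= enorm u.
Proof.
rewrite -sqrtr_sqr ler_sqrt ?dot_ge0// /dot (bigD1 i)//= -expr2 lerDl.
by apply: sumr_ge0 => j _; rewrite -expr2 sqr_ge0.
Qed.

Lemma norm_le_enorm u : `|u| <= enorm u.
Proof.
rewrite [leLHS]/Num.Def.normr/= mx_normrE (bigmax_le _ (enorm_ge0 u))// => -[i j] _.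
by rewrite /= ord1 normr_coord_le_enorm.
Qed.

Lemma enorm_eq0 u : enorm u = 0 -> u = 0.
Proof.
by move=> u0; apply/normr0_eq0/le_anti; rewrite normr_ge0 -{1}u0 norm_le_enorm.
Qed.

Lemma normr_coord_le_norm u (i : 'I_n) : `|u 0 i| <= `|u|.
Proof.
rewrite [leRHS]/Num.Def.normr/= mx_normrE.
exact: (le_bigmax _ (fun ij : 'I_1 * 'I_n => `|u ij.1 ij.2|) (0, i)).
Qed.

(** A crude constant is enough; [n.+1] avoids a square root and stays positive in dimension 0, so it
    can be divided by. *)
Lemma enorm_le_norm u : enorm u <= n.+1%:R * `|u|.
Proof.
have u0 : 0 <= n.+1%:R * `|u| by rewrite mulr_ge0.
rewrite -[leRHS]ger0_norm// -sqrtr_sqr ler_sqrt ?sqr_ge0//.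
apply: (@le_trans _ _ (\sum_(i < n) `|u| ^+ 2)).
  apply: ler_sum => i _; rewrite -expr2 -real_normK ?num_real//.
  by rewrite lerXn2r ?nnegrE// normr_coord_le_norm.
rewrite sumr_const card_ord -[leLHS]mulr_natl exprMn ler_wpM2r ?sqr_ge0//.
by rewrite -natrX ler_nat expnS expn1 mulSn mulnS; lia.
Qed.

Lemma cauchy_schwarz u v : `|dot u v| <= enorm u * enorm v.
Proof.
rewrite -[leRHS]ger0_norm ?mulr_ge0 ?enorm_ge0// -ler_sqr ?nnegrE//.
rewrite !real_normK ?num_real// exprMn !sqr_enorm.
have [v0|v_neq0] := eqVneq (dot v v) 0.
  have -> : v = 0 by apply: enorm_eq0; rewrite /enorm v0 sqrtr0.
  have -> : dot u 0 = 0 by rewrite -(scale0r v) dotZr mul0r.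
  by rewrite -(scale0r u) !dotZr !mul0r mulr0 expr0n.
have vgt0 : 0 < dot v v by rewrite lt_def v_neq0 dot_ge0.
(* This squared norm equals [d * (a * d - b ^+ 2)]; dividing by [d > 0] leaves the inequality. *)
have := dot_ge0 (dot v v *: u - dot u v *: v).
rewrite !(dotBl, dotBr, dotZl, dotZr) (dotC v u).
set a := dot u u; set b := dot u v; set d := dot v v.
rewrite [leRHS](_ : _ = d * (a * d - b ^+ 2)); last by ring.
by rewrite pmulr_rge0// subr_ge0.
Qed.

Lemma dot_le u v : dot u v <= enorm u * enorm v.
Proof. exact: le_trans (ler_norm _) (cauchy_schwarz u v). Qed.

Lemma enormD u v : enorm (u + v) <= enorm u + enorm v.
Proof.
rewrite -ler_sqr ?nnegrE ?addr_ge0 ?enorm_ge0//.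
rewrite sqr_enorm !(dotDl, dotDr) -!sqr_enorm (dotC v u).
by have := dot_le u v; lra.
Qed.

Lemma enormN u : enorm (- u) = enorm u.
Proof. by rewrite /enorm dotNl dotC dotNl opprK. Qed.

Lemma enormB u v : enorm (u - v) <= enorm u + enorm v.
Proof. by rewrite -(enormN v) enormD. Qed.

Lemma enormZ c u : enorm (c *: u) = `|c| * enorm u.
Proof.
by rewrite /enorm dotZl dotZr mulrA -expr2 sqrtrM ?sqr_ge0// sqrtr_sqr.
Qed.

Lemma cvg_enorm0 {T : Type} {F : set_system T} {FF : Filter F} (f : T -> 'rV[R]_n) :
  (fun t => enorm (f t)) @ F --> (0 : R) -> f @ F --> (0 : 'rV[R]_n).
Proof.
move=> /cvgr0Pnorm_lt f0; apply/cvgr0Pnorm_lt => e /f0.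
apply: filterS => t; apply: le_lt_trans.
by rewrite [leRHS]ger0_norm ?enorm_ge0// norm_le_enorm.
Qed.

End Euclidean.

(** * Operator norm bounds for a matrix and its transpose *)

Section Adjoint.
Context {R : realType} {m n : nat}.
Implicit Types (M : 'M[R]_(m, n)) (v : 'rV[R]_n) (y : 'rV[R]_m).

Lemma dot_mulmx M v y : dot (y *m M) v = dot y (v *m M^T).
Proof.
rewrite /dot.
under eq_bigr do rewrite mxE mulr_suml.
rewrite exchange_big; apply: eq_bigr => i _.
rewrite mxE mulr_sumr; apply: eq_bigr => j _.
by rewrite mxE mulrAC mulrA.
Qed.

(** Some finite bound is needed first: it makes the set defining [opnorm] bounded above, so that its
    [sup] is an upper bound. *)
Lemma enorm_mulmx_bound M : exists2 C, 0 <= C &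
  forall v, enorm (v *m M^T) <= C * enorm v.
Proof.
exists (m.+1%:R * (n%:R * `|M|)) => [|v]; first by rewrite !mulr_ge0.
apply: le_trans (enorm_le_norm _) _.
rewrite -mulrA ler_wpM2l// [leLHS]/Num.Def.normr/= mx_normrE.
apply: bigmax_le => [|[i j] _]; first by rewrite !mulr_ge0 ?enorm_ge0.
rewrite /= mxE; apply: le_trans (ler_norm_sum _ _ _) _.
rewrite (@le_trans _ _ (\sum_(k < n) `|M| * enorm v))//.
  apply: ler_sum => k _; rewrite ord1 normrM mulrC ler_pM// ?normr_coord_le_enorm//.
  rewrite mxE [leRHS]/Num.Def.normr/= mx_normrE.
  exact: (le_bigmax _ (fun ij : 'I_m * 'I_n => `|M ij.1 ij.2|) (j, k)).
by rewrite sumr_const card_ord -[leLHS]mulr_natl mulrA.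
Qed.

Lemma enorm_mulmx_le_opnorm M v :
  enorm (v *m M^T) <= opnorm M * enorm v.
Proof.
have [C C0 MC] := enorm_mulmx_bound M.
have [v0|v_neq0] := eqVneq (enorm v) 0.
  by rewrite v0 mulr0; have := MC v; rewrite v0 mulr0.
have v_gt0 : 0 < enorm v by rewrite lt_def v_neq0 enorm_ge0.
rewrite -ler_pdivrMr//.
apply: sup_ubound; last first.
  exists ((enorm v)^-1 *: v); last first.
    by rewrite -scalemxAl enormZ ger0_norm ?invr_ge0 ?enorm_ge0// mulrC.
  by rewrite /= enormZ ger0_norm ?invr_ge0 ?enorm_ge0// mulVf.
exists C => _ [w /= w1 <-]; apply: le_trans (MC w) _.
by rewrite ler_piMr.
Qed.

(* Duality: [|yM|^2 = <y, M (yM)>]. *)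
Lemma enorm_tr_mulmx_le_opnorm M y :
  enorm (y *m M) <= opnorm M * enorm y.
Proof.
(* Here only [0 <= opnorm M] remains, and the zero vector puts a nonnegative value in the set. *)
have [->|w_neq0] := eqVneq (enorm (y *m M)) 0.
  rewrite mulr_ge0 ?enorm_ge0//.
  apply: le_trans (sup_ubound _ (ex_intro2 _ _ 0 _ erefl)); rewrite /=.
  - exact: enorm_ge0.
  - have [C C0 MC] := enorm_mulmx_bound M.
    exists C => _ [w /= w1 <-]; apply: le_trans (MC w) _.
    by rewrite ler_piMr.
  - by rewrite /enorm /dot big1 ?sqrtr0// => i _; rewrite mxE mul0r.
have w_gt0 : 0 < enorm (y *m M) by rewrite lt_def w_neq0 enorm_ge0.
rewrite -(ler_pM2r w_gt0) -expr2 sqr_enorm dot_mulmx.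
apply: le_trans (dot_le _ _) _.
rewrite mulrC mulrAC ler_wpM2r ?enorm_ge0//.
exact: enorm_mulmx_le_opnorm.
Qed.

End Adjoint.

(** * Entrywise limits of matrices, products and inner products *)

Section Convergence.
Context {R : realType} {T : Type} {F : set_system T} {FF : Filter F}.

Lemma cvg_sum_ord {k : nat} (f : 'I_k -> T -> R) (a : 'I_k -> R) :
  (forall i, f i @ F --> a i) ->
  (fun t => \sum_(i < k) f i t) @ F --> \sum_(i < k) a i.
Proof.
by move=> fa; apply: cvg_big => [|i _]; [exact: add_continuous|exact: fa].
Qed.

Lemma cvg_mx {k l : nat} (f : T -> 'M[R]_(k, l)) (A : 'M[R]_(k, l)) :
  (forall i j, (fun t => f t i j) @ F --> A i j) -> f @ F --> A.
Proof.
move=> fA; apply/cvgrPdist_le => /= e e0.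
have : \forall t \near F, forall ij : 'I_k * 'I_l, `|A ij.1 ij.2 - f t ij.1 ij.2| <= e.
  by apply: filter_forall => ij; apply: cvgr_dist_le (fA _ _) e e0.
apply: filterS => t fAt; rewrite [leLHS]/Num.Def.normr/= mx_normrE.
by apply: bigmax_le => [|ij _]; [exact: ltW|rewrite !mxE fAt].
Qed.

Lemma cvg_mx_entry {k l : nat} (f : T -> 'M[R]_(k, l)) (A : 'M[R]_(k, l)) i j :
  f @ F --> A -> (fun t => f t i j) @ F --> A i j.
Proof. exact: (@continuous_cvg _ _ _ F FF f (fun M : 'M[R]_(k, l) => M i j) A
  (@coord_continuous _ _ _ i j A)). Qed.

Lemma cvg_mulmx {k l p : nat} (f : T -> 'M[R]_(k, l)) (g : T -> 'M[R]_(l, p))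
    (A : 'M[R]_(k, l)) (B : 'M[R]_(l, p)) :
  f @ F --> A -> g @ F --> B -> (fun t => f t *m g t) @ F --> A *m B.
Proof.
move=> fA gB; apply: cvg_mx => i j; rewrite mxE; under eq_fun do rewrite mxE.
by apply: cvg_sum_ord => o; apply: cvgM; exact: cvg_mx_entry.
Qed.

Lemma cvg_dot {k : nat} (f g : T -> 'rV[R]_k) (a b : 'rV[R]_k) :
  f @ F --> a -> g @ F --> b -> (fun t => dot (f t) (g t)) @ F --> dot a b.
Proof.
by move=> fa gb; apply: cvg_sum_ord => o; apply: cvgM; exact: cvg_mx_entry.
Qed.

End Convergence.

Lemma cvg_within_natSinv {R : realType} {V : normedModType R} (f g : nat -> V) (l : V) :
  (forall k, `|f k - g k| < k.+1%:R^-1) -> g @ \oo --> l -> f @ \oo --> l.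
Proof.
move=> fg gl; have -> : f = (f - g) + g by apply/funext => k /=; rewrite subrK.
rewrite -[l]add0r; apply: cvgD => //.
apply/cvgr0Pnorm_lt => e e0; have := near_infty_natSinv_lt (PosNum e0).
by apply: filterS => k /=; apply: lt_trans; exact: fg.
Qed.

(** * The x-gradient of the augmented Lagrangian *)

Section Gradient.
Context {R : realType} {n m : nat}.

Lemma grad_x_lagrangianE (f0 : 'rV[R]_n -> R) (F : 'rV[R]_n -> 'rV[R]_m) rho x u y :
  differentiable f0 x -> differentiable F x ->
  grad_x_lagrangian f0 F rho x u y =
    grad f0 x + (y + rho *: (F x - u)) *m nabla F x.
Proof.
move=> df0 dF; apply/rowP => i; rewrite !mxE; set v := delta_mx 0 i.
have Fi j : is_derive x v (fun x => F x 0 j) (nabla F x j i).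
  have dFv : derivable F x v by exact: diff_derivable.
  have dFj : derivable (fun x => F x 0 j) x v by exact: (derivable_mxP _ _ _).1.
  apply: is_derive_eq; first exact: derivableP dFj.
  have := derive_mx dFv; rewrite deriveEjacobian// => /rowP/(_ j).
  by rewrite [X in _ = X -> _]mxE => <-; rewrite -rowE !mxE.
pose G j := (fun x => F x 0 j) - cst (u 0 j).
have Gi j : is_derive x v (G j) (nabla F x j i).
  by apply: is_derive_eq; rewrite subr0.
(* Written coordinatewise in [G j], the j-th entry of [F - u], the function is a sum of scalar
   products to which the derivation rules apply. *)
have -> : (fun x' => lagrangian_smooth f0 F rho x' u y) =
    f0 + \sum_(j < m) ((y 0 j) \*: G j + (rho / 2) \*: (G j * G j)).
  apply/funext => z; rewrite /lagrangian_smooth sqr_enorm !fctE -addrA; congr (_ + _).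
  rewrite /dot mulr_sumr -big_split fct_sumE; apply: eq_bigr => j _.
  by rewrite !mxE.
have f0i : is_derive x v f0 ('D_v f0 x).
  by apply: derivableP; exact: diff_derivable.
have Hi j : is_derive x v (y 0 j \*: G j + (rho / 2) \*: (G j * G j))
    (y 0 j *: nabla F x j i +
     (rho / 2) *: (G j x *: nabla F x j i + G j x *: nabla F x j i)).
  by apply: is_deriveD; apply: is_deriveZ; exact: is_deriveM.
rewrite (@derive_val _ _ _ _ _ _ _ (is_deriveD f0i (is_derive_sum Hi))).
congr (_ + _); apply: eq_bigr => j _.
by rewrite !mxE /GRing.scale/= /G !fctE; field.
Qed.

End Gradient.

(** * Closedness of the limiting subdifferential, and a sum rule for the Lagrangian *)

Section Subdifferential.
Context {R : realType} {n m : nat}.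
Implicit Types (h : 'rV[R]_m -> \bar R) (u v w y : 'rV[R]_m) (x : 'rV[R]_n).

Lemma limiting_subdiff_fin_num h u v : limiting_subdiff h u v -> h u \is a fin_num.
Proof. by case. Qed.

(* A diagonal sequence is the witness. *)
Lemma limiting_subdiff_closed h u v (us vs : nat -> 'rV[R]_m) :
  h u \is a fin_num -> us @ \oo --> u -> (h \o us) @ \oo --> h u ->
  (forall k, limiting_subdiff h (us k) (vs k)) -> vs @ \oo --> v ->
  limiting_subdiff h u v.
Proof.
move=> hu usu hus hsub vsv; split=> //.
(* Each limiting subgradient is replaced by a regular one that is [1/(k+1)]-close in point, value
   and slope. [fine] loses nothing, since a regular subgradient forces a finite value. *)
have approx k : exists p : 'rV[R]_m * 'rV[R]_m,
    [/\ regular_subdiff h p.1 p.2, `|p.1 - us k| < k.+1%:R^-1,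
        `|fine (h p.1) - fine (h (us k))| < k.+1%:R^-1
      & `|p.2 - vs k| < k.+1%:R^-1].
  have [husk [ws [zs [wsu hws reg zsv]]]] := hsub k.
  have k0 : (0 : R) < k.+1%:R^-1 by rewrite invr_gt0.
  have fws : fine (h (ws i)) @[i --> \oo] --> fine (h (us k)).
    by apply: fine_cvg; rewrite fineK.
  have close (V : normedModType R) (a : nat -> V) (l : V) :
      a @ \oo --> l -> \forall i \near \oo, `|a i - l| < k.+1%:R^-1.
    by move/cvgrPdistC_lt; apply.
  have [i [? [? ?]]] := @filter_ex _ _ _ _
    (filterI (close _ _ _ wsu) (filterI (close _ _ _ fws) (close _ _ _ zsv))).
  by exists (ws i, zs i); split=> //=.
have [p pP] := choice approx.
exists (fst \o p), (snd \o p); split.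
- by apply: cvg_within_natSinv usu => k; have [] := pP k.
- rewrite -(fineK hu); apply/fine_cvgP; split.
    by apply: nearW => k; have [[]] := pP k.
  apply: cvg_within_natSinv (_ : fine \o (h \o us) @ \oo --> _).
    by move=> k; have [] := pP k.
  by apply: fine_cvg; rewrite fineK.
- by move=> k; have [] := pP k.
- by apply: cvg_within_natSinv vsv => k; have [] := pP k.
Qed.

(** The smooth part is quadratic in u, so its second-order expansion is exact; its slope at u is
    minus the updated multiplier. *)
Lemma lagrangian_smooth_expand (f0 : 'rV[R]_n -> R) (F : 'rV[R]_n -> 'rV[R]_m)
    rho x u w y :
  lagrangian_smooth f0 F rho x w y =
    lagrangian_smooth f0 F rho x u y - dot (y + rho *: (F x - u)) (w - u)
      + rho / 2 * enorm (w - u) ^+ 2.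
Proof.
rewrite /lagrangian_smooth !sqr_enorm.
have -> : F x - w = (F x - u) - (w - u) by rewrite opprB addrA subrK.
move: (F x - u) (w - u) => a b.
rewrite !(dotBl, dotBr, dotDl, dotZl) (dotC b a)/=; lra.
Qed.

Lemma cvg_lagrangian_smooth (f0 : 'rV[R]_n -> R) (F : 'rV[R]_n -> 'rV[R]_m)
    rho x u y (us : nat -> 'rV[R]_m) :
  us @ \oo --> u ->
  lagrangian_smooth f0 F rho x (us k) y @[k --> \oo] -->
    lagrangian_smooth f0 F rho x u y.
Proof.
move=> usu; have Fus : F x - us k @[k --> \oo] --> F x - u.
  by apply: cvgB => //; exact: cvg_cst.
rewrite /lagrangian_smooth; apply: cvgD.
  by apply: cvgD; [exact: cvg_cst|apply: cvg_dot => //; exact: cvg_cst].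
apply: cvgM; first exact: cvg_cst.
by rewrite sqr_enorm; under eq_fun do rewrite sqr_enorm; exact: cvg_dot.
Qed.

Lemma near_enorm_lt u (e : R) : 0 < e -> \forall w \near u, enorm (w - u) < e.
Proof.
move=> e0; have d0 : 0 < e / m.+1%:R by rewrite divr_gt0.
have : \forall w \near u, `|w - u| < e / m.+1%:R.
  by apply/nbhs_normP; exists (e / m.+1%:R) => // w /=; rewrite distrC.
apply: filterS => w; rewrite ltr_pdivlMr// mulrC.
exact: le_lt_trans (enorm_le_norm _).
Qed.

Lemma regular_subdiff_lagrangian (f0 : 'rV[R]_n -> R) (F : 'rV[R]_n -> 'rV[R]_m)
    h rho x u v y :
  0 < rho ->
  regular_subdiff (fun w => lagrangian f0 F h rho x w y) u v ->
  regular_subdiff h u (v + (y + rho *: (F x - u))).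
Proof.
move=> rho0 [Lu Lsub].
have hu : h u \is a fin_num by move: Lu; rewrite fin_numD => /andP[].
split=> // e e0.
(* One half of [e] pays for the subgradient inequality, the other for the quadratic remainder:
   within radius [e / rho], [rho / 2 * d ^+ 2 <= e / 2 * d]. *)
have e20 : 0 < e / 2 by rewrite divr_gt0.
have := near_enorm_lt u _ (divr_gt0 e0 rho0); apply: filterS2 (Lsub _ e20) => w.
rewrite /lagrangian (lagrangian_smooth_expand _ _ _ _ u w).
rewrite (dotDl v); move: (lagrangian_smooth _ _ _ _ _ _) (dot (y + _) _) => s q.
have := enorm_ge0 (w - u); set d := enorm _ => d0.
rewrite -(fineK hu); case: (h w) => [r| |] /=; last by [].
- rewrite -!EFinD !lee_fin => sub; rewrite ltr_pdivlMr// => de.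
  have : rho / 2 * d ^+ 2 <= e / 2 * d.
    by rewrite expr2 mulrA ler_wpM2r//; lra.
  by lra.
- by move=> _ _; rewrite leey.
Qed.

Lemma limiting_subdiff_lagrangian (f0 : 'rV[R]_n -> R) (F : 'rV[R]_n -> 'rV[R]_m)
    h rho x u v y :
  0 < rho ->
  limiting_subdiff (fun w => lagrangian f0 F h rho x w y) u v ->
  limiting_subdiff h u (v + (y + rho *: (F x - u))).
Proof.
move=> rho0 [Lu [us [vs [usu Lus reg vsv]]]].
have hu : h u \is a fin_num by move: Lu; rewrite fin_numD => /andP[].
split=> //; exists us, (fun k => vs k + (y + rho *: (F x - us k))); split=> //.
(* The values of h converge because h is the Lagrangian minus its smooth part, which is finite and
   continuous in u. *)
- have -> : h \o us = fun k => ((lagrangian f0 F h rho x (us k) y)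
      + (- lagrangian_smooth f0 F rho x (us k) y)%:E)%E.
    by apply/funext => k /=; rewrite /lagrangian addeAC -EFinD subrr add0e.
  have -> : h u = (lagrangian f0 F h rho x u y
      + (- lagrangian_smooth f0 F rho x u y)%:E)%E.
    by rewrite /lagrangian addeAC -EFinD subrr add0e.
  apply: cvgeD => //; first by rewrite fin_num_adde_defl.
  apply: cvg_EFin; first exact: nearW.
  by apply: cvgN; exact: cvg_lagrangian_smooth.
- by move=> k; exact: regular_subdiff_lagrangian (reg k).
- apply: cvgD => //; apply: cvgD; first exact: cvg_cst.
  by apply: cvgZr; apply: cvgB => //; exact: cvg_cst.
Qed.

End Subdifferential.

Lemma dist_set_le {R : realType} {m : nat} (u w : 'rV[R]_m) (A : set 'rV[R]_m) :
  A w -> dist_set u A <= enorm (u - w).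
Proof.
move=> Aw; apply: ge_inf; last by exists w.
by exists 0 => _ [v _ <-]; exact: enorm_ge0.
Qed.

(** * Estimates along a Lagrangian sequence with bounded multipliers *)

Section LagrangianSequence.
Context {R : realType} {n m : nat} {f0 : 'rV[R]_n -> R} {F : 'rV[R]_n -> 'rV[R]_m}
  {h : 'rV[R]_m -> \bar R} {Z : set 'rV[R]_n} {gamma LF Lf0 a b delta tau M : R}
  {A : R -> 'rV[R]_n -> 'rV[R]_m -> 'rV[R]_m -> set ('rV[R]_n * 'rV[R]_m)}
  {xm1 : 'rV[R]_n} {x : nat -> 'rV[R]_n} {u y : nat -> 'rV[R]_m} {rho : nat -> R}.
Hypothesis f0_diff : forall x, differentiable f0 x.
Hypothesis F_diff : forall x, differentiable F x.
Hypothesis h_well_posed : well_posed f0 F h.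
Hypothesis hZ : information_zone F h Z.
Hypothesis h_regular : regular_on_zone f0 F Z gamma LF Lf0.
Hypotheses (gamma_gt0 : 0 < gamma) (LF_ge0 : 0 <= LF) (Lf0_ge0 : 0 <= Lf0).
Hypotheses (b_gt0 : 0 < b) (delta_gt0 : 0 < delta) (tau_gt0 : 0 < tau)
  (tau_lt : tau < a / 2) (rho0_gt0 : 0 < rho 0%N).
Hypothesis z_lagrangian :
  lagrangian_sequence f0 F h Z gamma a b delta tau A xm1 x u y rho.
Hypothesis y_bounded : forall k, enorm (y k) <= M.

Let step k := enorm (x k.+1 - x k).
Let ystep k := enorm (y k.+1 - y k).
(** Weight of the latest primal step in the multiplier bound: [b] from the gradient residual, [Lf0]
    from the variation of [grad f0], [LF * M] from that of [nabla F] applied to a multiplier of norm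
    at most [M]. *)
Let C := b + Lf0 + LF * M.

Lemma penalty_nondecreasing k : rho k <= rho k.+1.
Proof.
have [alb _ _ _ _] := z_lagrangian; have [_ _ _ ->] := alb k.
by case: ifP => // _; rewrite lerDl ltW.
Qed.

Lemma penalty_homo i j : (i <= j)%N -> rho i <= rho j.
Proof. by move/(nondecreasing_seqP _).1 : penalty_nondecreasing; apply. Qed.

Lemma penalty_gt0 k : 0 < rho k.
Proof. exact: lt_le_trans rho0_gt0 (penalty_homo _ _ (leq0n k)). Qed.

Lemma multiplier_update k : y k.+1 = y k + rho k *: (F (x k.+1) - u k.+1).
Proof. by have [alb _ _ _ _] := z_lagrangian; have [] := alb k. Qed.

Lemma feasibility_gap k : rho k * enorm (F (x k.+1) - u k.+1) = ystep k.
Proof.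
rewrite /ystep multiplier_update addrAC subrr add0r enormZ.
by rewrite ger0_norm ?ltW ?penalty_gt0.
Qed.

(** This is (C2): the multiplier update turns [y k + rho k *: (F (x k.+1) - u k.+1)] into
    [y k.+1]. *)
Lemma gradient_bound k :
  enorm (grad f0 (x k.+1) + y k.+1 *m nabla F (x k.+1)) <= b * step k.
Proof.
have [_ _ C2 _ _] := z_lagrangian.
by have := C2 k; rewrite grad_x_lagrangianE// -multiplier_update.
Qed.

Lemma multiplier_subdiff : exists2 c, 0 < c & forall k,
  exists2 w, limiting_subdiff h (u k.+1) (w + y k.+1) & enorm w <= c * step k.
Proof.
have [_ _ _ [c c0 C3] _] := z_lagrangian; exists c => // k.
have [w hw wc] := C3 k; exists w => //.
by rewrite multiplier_update; exact: limiting_subdiff_lagrangian (penalty_gt0 k) hw.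
Qed.

(** Subgradients exist only where h is finite. (C3) supplies them from index 1 on, while the initial
    [u 0] is arbitrary. *)
Lemma h_fin_num k : h (u k.+1) \is a fin_num.
Proof.
have [c _ sub] := multiplier_subdiff; have [w + _] := sub k.
exact: limiting_subdiff_fin_num.
Qed.

(** Uniform regularity reduces the multiplier step to its image under the transposed Jacobian. That
    image is a difference of two consecutive gradient residuals, up to the variation of [grad f0]
    and [nabla F]. *)
Lemma multiplier_step_bound k : Z (x k.+1) -> Z (x k.+2) ->
  gamma * ystep k.+1 <= C * step k.+1 + b * step k.
Proof.
move=> Zx1 Zx2; have [lb LipF Lipf0] := h_regular.
apply: le_trans (lb _ _ Zx2) _.
pose g k := grad f0 (x k) + y k *m nabla F (x k).
have -> : (y k.+2 - y k.+1) *m nabla F (x k.+2) =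
    (g k.+2 - g k.+1) - ((grad f0 (x k.+2) - grad f0 (x k.+1)) +
      y k.+1 *m (nabla F (x k.+2) - nabla F (x k.+1))).
  rewrite /g mulmxBl mulmxBr.
  have regroup (p q r s t : 'rV[R]_n) :
      p - r = (s + p - (t + q)) - ((s - t) + (r - q)).
    by apply/rowP => i; rewrite !mxE; ring.
  exact: regroup.
apply: le_trans (enormB _ _) _.
have -> : C * step k.+1 + b * step k = b * step k.+1 + b * step k +
    (Lf0 * step k.+1 + LF * step k.+1 * M).
  by rewrite /C; move: (step k) (step k.+1) => s1 s2; ring.
apply: lerD; [apply: le_trans (enormB _ _) _|apply: le_trans (enormD _ _) _].
  by apply: lerD; exact: gradient_bound.
apply: lerD; first exact: Lipf0.
apply: le_trans (enorm_tr_mulmx_le_opnorm _ _) _.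
apply: le_trans (ler_wpM2r (enorm_ge0 _) (LipF _ _ Zx2 Zx1)) _.
by rewrite ler_wpM2l ?y_bounded// mulr_ge0 ?enorm_ge0.
Qed.

(** * Decrease of the Lyapunov function and stabilization of the penalty *)

Let energy (r be : R) k :=
  lagrangian_smooth f0 F r (x k) (u k) (y k) + fine (h (u k))
  + be * enorm (x k - Defs.prev xm1 x k) ^+ 2.

Lemma lyapunovE r be k :
  lyapunov f0 F h r be (x k.+1) (u k.+1) (y k.+1) (x k) = (energy r be k.+1)%:E.
Proof. by rewrite /lyapunov /lagrangian -(fineK (h_fin_num k)). Qed.

Let beta r := 2 * b ^+ 2 / (r * gamma ^+ 2).

(** Above this penalty, [kappa * (C ^+ 2 + b ^+ 2)] fits into the slack [a / 2 - tau] between the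
    guaranteed descent and the acceptance test. *)
Let threshold := 2 * (C ^+ 2 + b ^+ 2) / (gamma ^+ 2 * (a / 2 - tau)).

(* With [kappa = 2 / (rho gamma^2)], the multiplier step costs at most
   [kappa C^2 |dx'|^2 + kappa b^2 |dx|^2], and [beta = kappa b^2] telescopes the
   second term. *)
Lemma energy_decrease k : Z (x k.+1) -> Z (x k.+2) -> threshold <= rho k.+1 ->
  tau * step k.+1 ^+ 2 <=
    energy (rho k.+1) (beta (rho k.+1)) k.+1
    - energy (rho k.+1) (beta (rho k.+1)) k.+2.
Proof.
move=> Zx1 Zx2 large; have r0 := penalty_gt0 k.+1.
have [_ C1 _ _ _] := z_lagrangian.
have {C1} : a / 2 * step k.+1 ^+ 2
    + (lagrangian_smooth f0 F (rho k.+1) (x k.+2) (u k.+2) (y k.+1)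
       + fine (h (u k.+2)))
    <= lagrangian_smooth f0 F (rho k.+1) (x k.+1) (u k.+1) (y k.+1)
       + fine (h (u k.+1)).
  have := C1 k.+1; rewrite /lagrangian.
  by rewrite -(fineK (h_fin_num k)) -(fineK (h_fin_num k.+1)) -!EFinD lee_fin.
(* The dual update raises the Lagrangian by the inner product of the multiplier step with [F - u],
   which is that step divided by [rho]. *)
have : lagrangian_smooth f0 F (rho k.+1) (x k.+2) (u k.+2) (y k.+2)
    = lagrangian_smooth f0 F (rho k.+1) (x k.+2) (u k.+2) (y k.+1)
      + ystep k.+1 ^+ 2 / rho k.+1.
  rewrite /ystep sqr_enorm {1}/lagrangian_smooth multiplier_update.
  rewrite [y k.+1 + _ - _]addrAC subrr add0r !(dotDl, dotZl, dotZr).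
  by rewrite /lagrangian_smooth; field; rewrite gt_eqF.
rewrite /energy /= -/(step k) -/(step k.+1).
have := multiplier_step_bound _ Zx1 Zx2.
have : 0 <= step k := enorm_ge0 _; have : 0 <= step k.+1 := enorm_ge0 _.
have : 0 <= ystep k.+1 := enorm_ge0 _.
move: (step k) (step k.+1) (ystep k.+1) => d1 d2 dy dy0 d20 d10 dyle.
have dy2 : (gamma * dy) ^+ 2 <= 2 * (C * d2) ^+ 2 + 2 * (b * d1) ^+ 2.
  have gdy : 0 <= gamma * dy by rewrite mulr_ge0// ltW.
  apply: (@le_trans _ _ ((C * d2 + b * d1) ^+ 2)).
    by rewrite lerXn2r ?nnegrE// (le_trans gdy).
  by have := sqr_ge0 (C * d2 - b * d1); lra.
pose kappa := 2 / (rho k.+1 * gamma ^+ 2).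
have g2 : 0 < gamma ^+ 2 by rewrite exprn_gt0.
have dyk : dy ^+ 2 / rho k.+1 <= kappa * C ^+ 2 * d2 ^+ 2 + kappa * b ^+ 2 * d1 ^+ 2.
  rewrite (_ : dy ^+ 2 / rho k.+1 = (gamma * dy) ^+ 2 / (rho k.+1 * gamma ^+ 2)).
    rewrite [leRHS](_ : _ = (2 * (C * d2) ^+ 2 + 2 * (b * d1) ^+ 2)
        / (rho k.+1 * gamma ^+ 2)).
      by rewrite ler_wpM2r// invr_ge0 ltW// mulr_gt0.
    by rewrite /kappa; field; rewrite !gt_eqF.
  by field; rewrite !gt_eqF.
have -> : beta (rho k.+1) = kappa * b ^+ 2.
  by rewrite /beta /kappa; field; rewrite !gt_eqF.
(* The part with [C] comes from the multiplier step, the part with [b] from the proximal term of the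
   new Lyapunov value. *)
have : kappa * (C ^+ 2 + b ^+ 2) <= a / 2 - tau.
  have at0 : 0 < a / 2 - tau by rewrite subr_gt0.
  move: large; rewrite /threshold ler_pdivrMr ?mulr_gt0// => large.
  rewrite /kappa mulrAC ler_pdivrMr ?mulr_gt0//.
  by apply: le_trans large _; rewrite le_eqVlt; apply/orP; left; apply/eqP; ring.
move=> /(ler_wpM2r (sqr_ge0 d2)).
move: dyk; set q := dy ^+ 2 / rho k.+1.
move: (lagrangian_smooth _ _ _ (x k.+1) _ _) (lagrangian_smooth _ _ _ _ _ (y k.+1)).
by move=> S1 S21 qle kap -> C1; lra.
Qed.

(** The multiplier step is at most [2 * M], so the feasibility gap is at most [2 * M / rho k]; as
    [u k.+1] lies in [dom h], this also bounds the distance of [F (x k.+1)] to [dom h]. *)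
Lemma in_zone_of_large_penalty : exists B, forall k, B <= rho k -> Z (x k.+1).
Proof.
have [d d0 [dZ _]] := hZ.
have M0 : 0 <= M := le_trans (enorm_ge0 _) (y_bounded 0%N).
have inZ k : (((2 * M) / rho k)%:E <= d)%E -> Z (x k.+1).
  move=> kd; apply: dZ => /=; apply: le_trans kd; rewrite lee_fin.
  have domu : dom h (u k.+1) by rewrite /dom/= ltey_eq h_fin_num.
  apply: le_trans (dist_set_le _ _ _ domu) _.
  rewrite ler_pdivlMr ?penalty_gt0// mulrC feasibility_gap.
  apply: le_trans (enormB _ _) _.
  by have := y_bounded k; have := y_bounded k.+1; lra.
case: d d0 {dZ} inZ => [d| |] // d0 inZ.
- rewrite lte_fin in d0; exists (2 * M / d) => k Bk; apply: inZ; rewrite lee_fin.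
  by rewrite ler_pdivrMr ?penalty_gt0// [leRHS]mulrC -ler_pdivrMr.
- by exists 0 => k _; apply: inZ; rewrite leey.
Qed.

Lemma penalty_eventually_constant : exists K, forall k, (K <= k)%N ->
  [/\ rho k = rho K, Z (x k.+1) &
      tau * step k.+1 ^+ 2 <= energy (rho K) (beta (rho K)) k.+1
                             - energy (rho K) (beta (rho K)) k.+2].
Proof.
have [alb _ _ _ _] := z_lagrangian.
pose update k := (x k.+1 \notin Z) ||
  (lyapunov f0 F h (rho k) (beta (rho k)) (x k) (u k) (y k) (Defs.prev xm1 x k)
   - lyapunov f0 F h (rho k) (beta (rho k)) (x k.+1) (u k.+1) (y k.+1) (x k)
   < (tau * step k ^+ 2)%:E)%E.
have rhoS k : rho k.+1 = if update k then rho k + delta else rho k.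
  by have [_ _ _ ->] := alb k.
(* From index 1 on the Lyapunov values are finite, so the test becomes a comparison of reals. *)
have updateS k : update k.+1 = (x k.+2 \notin Z) ||
    (energy (rho k.+1) (beta (rho k.+1)) k.+1
     - energy (rho k.+1) (beta (rho k.+1)) k.+2 < tau * step k.+1 ^+ 2).
  by rewrite /update /= !lyapunovE -EFinB lte_fin.
suff [K noup] : exists K, forall k, (K <= k)%N -> ~~ update k.
  exists K => k Kk.
  have rK j : (K <= j)%N -> rho j = rho K.
    elim: j => [|j IH]; first by rewrite leqn0 => /eqP ->.
    rewrite leq_eqVlt => /orP[/eqP -> //|/[!ltnS] Kj].
    by rewrite rhoS (negbTE (noup _ Kj)) IH.
  split; first exact: rK.
    by have := noup _ Kk; rewrite negb_or negbK => /andP[/set_mem].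
  have := noup _ (leqW Kk).
  by rewrite updateS negb_or -leNgt rK ?leqW// => /andP[].
(* With infinitely many updates the penalty is unbounded, and then
   [energy_decrease] rules out any further update. *)
apply: contrapT => /forallNP often.
have unbounded N : exists k, rho 0%N + N%:R * delta <= rho k.
  elim: N => [|N [k kN]]; first by exists 0%N; rewrite mul0r addr0.
  have /existsNP[j /not_implyP[kj /negP/negPn up]] := often k.
  exists j.+1; rewrite rhoS up -natr1 mulrDl mul1r addrA lerD2r.
  exact: le_trans kN (penalty_homo _ _ kj).
have large B : exists K, forall k, (K <= k)%N -> B <= rho k.
  have [N BN] : exists N : nat, B / delta < N%:R.
    by exists (Num.truncn (B / delta)).+1; exact: truncnS_gt.
  have [K KN] := unbounded N; exists K => k /penalty_homo; apply: le_trans.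
  apply: le_trans KN; move: BN; rewrite ltr_pdivrMr// => /ltW BN.
  by apply: le_trans BN _; rewrite lerDr ltW.
have [B inZ] := in_zone_of_large_penalty.
have [K1 K1Z] := large B; have [K2 K2t] := large threshold.
(* The offset makes the index of this update a successor [j.+1], with [j] itself past [K1]: both
   [x j.+1] and [x j.+2] are then in the zone. *)
have /existsNP[j /not_implyP[Kj /negP/negPn]] := often (K1 + K2).+2.
case: j Kj => // j Kj.
have [jK1 jK1' jK2] : [/\ (K1 <= j.+1)%N, (K1 <= j)%N & (K2 <= j.+1)%N] by split; lia.
rewrite updateS => /orP[/negP|]; first by apply; apply/mem_set/inZ/K1Z.
rewrite ltNge => /negP; apply; apply: energy_decrease; last exact: K2t.
  exact/inZ/K1Z.
exact/inZ/K1Z.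
Qed.

(* Half of the penalty term absorbs the multiplier term, so well-posedness at
   [y = 0] suffices. *)
Lemma energy_bounded_below r be : 0 < r -> 0 <= be ->
  exists mu, forall k, mu <= energy r be k.+1.
Proof.
move=> r0 be0; have r20 : 0 < r / 2 by rewrite divr_gt0.
have [mu muL] : exists mu : R, forall v w, (mu%:E <= lagrangian f0 F h (r / 2) v w 0)%E.
  have := h_well_posed (r / 2) 0 r20.
  set S := [set _ | _ in _] => infS.
  have Sinf v w : (ereal_inf S <= lagrangian f0 F h (r / 2) v w 0)%E.
    by apply: ereal_inf_lbound; exists (v, w).
  case: (ereal_inf S) infS Sinf => [s| |] // _ Sinf; first by exists s.
  (* If the infimum is [+oo], any real is a lower bound. *)
  by exists 0 => v w; apply: le_trans (Sinf v w); rewrite leey.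
exists (mu - M ^+ 2 / r) => k.
have := muL (x k.+1) (u k.+1); rewrite /lagrangian -(fineK (h_fin_num k)) lee_fin.
have : 0 <= be * enorm (x k.+1 - Defs.prev xm1 x k.+1) ^+ 2 by rewrite mulr_ge0 ?sqr_ge0.
rewrite /energy /lagrangian_smooth; move: (F _ - _) => w.
have -> : dot 0 w = 0 by rewrite -(scale0r 0) dotZl mul0r.
have := cauchy_schwarz (y k.+1) w; rewrite ler_norml => /andP[+ _].
have : enorm (y k.+1) * enorm w <= M * enorm w.
  by rewrite ler_wpM2r ?enorm_ge0.
(* Completing the square: the spare [r / 4 * enorm w ^+ 2] dominates [M * enorm w] up to
   [M ^+ 2 / r]. *)
have : 0 <= (enorm w * r / 2 - M) ^+ 2 / r by rewrite divr_ge0 ?sqr_ge0// ltW.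
have -> : (enorm w * r / 2 - M) ^+ 2 / r =
    r / 4 * enorm w ^+ 2 - M * enorm w + M ^+ 2 / r.
  by field; rewrite gt_eqF.
by lra.
Qed.

(** * Vanishing of the primal steps and of the feasibility gap *)

Lemma step_cvg0 : step k @[k --> \oo] --> (0 : R).
Proof.
have [K constK] := penalty_eventually_constant.
(* Past [K] the penalty is frozen, so this is a single nonincreasing sequence bounded below; its
   increments vanish and dominate [tau] times the squared steps. *)
pose e k := energy (rho K) (beta (rho K)) (k + K).+1.
have eS k : tau * step (k + K).+1 ^+ 2 <= e k - e k.+1.
  by have [] := constK (k + K)%N (leq_addl _ _).
have beta0 : 0 <= beta (rho K).
  by apply: divr_ge0; apply: mulr_ge0; rewrite ?sqr_ge0 ?(ltW (penalty_gt0 _)).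
have [mu mue] := energy_bounded_below (rho K) (beta (rho K)) (penalty_gt0 K) beta0.
have ecvg : cvgn e.
  apply: nonincreasing_is_cvgn; last by exists mu => _ [k _ <-]; exact: mue.
  apply/nonincreasing_seqP => k; rewrite -subr_ge0; apply: le_trans (eS k).
  by rewrite mulr_ge0 ?sqr_ge0// ltW.
have e0 : e k - e k.+1 @[k --> \oo] --> (0 : R).
  rewrite -(subrr (limn e)); apply: cvgB => //.
  by rewrite (cvg_shiftS e).
rewrite -(cvg_shiftn K.+1); apply/cvgr0Pnorm_lt => d d0.
have td0 : 0 < tau * d ^+ 2 by rewrite mulr_gt0 ?exprn_gt0.
move/cvgr0Pnorm_lt : e0 => /(_ _ td0); apply: filterS => k.
move=> /(le_lt_trans (ler_norm _))/(le_lt_trans (eS k)).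
rewrite ltr_pM2l// => sd; rewrite /= addnS ger0_norm ?enorm_ge0//.
by rewrite -(@ltr_pXn2r _ 2) ?nnegrE ?enorm_ge0// ltW.
Qed.

(** With the penalty frozen, the gap is the multiplier step over [rho K], hence controlled by the
    last two primal steps. *)
Lemma gap_cvg0 : F (x k.+1) - u k.+1 @[k --> \oo] --> (0 : 'rV[R]_m).
Proof.
have [K constK] := penalty_eventually_constant.
apply: cvg_enorm0; have r0 := penalty_gt0 K.
rewrite -(cvg_shiftn K.+1).
have step0 : (gamma * rho K)^-1 * (C * step (k + K).+1 + b * step (k + K))
    @[k --> \oo] --> (0 : R).
  have -> : 0 = (gamma * rho K)^-1 * (C * 0 + b * 0) by rewrite !mulr0 addr0 mulr0.
  apply: cvgM; first exact: cvg_cst.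
  apply: cvgD; (apply: cvgM; first exact: cvg_cst).
    by have := step_cvg0; rewrite -(cvg_shiftn K.+1); under eq_fun do rewrite addnS.
  by have := step_cvg0; rewrite -(cvg_shiftn K).
apply: squeeze_cvgr (cvg_cst _) step0; apply: nearW => k.
rewrite /= addnS enorm_ge0/= [leRHS]mulrC ler_pdivlMr ?mulr_gt0//.
have [rk Zk _] := constK (k + K)%N (leq_addl _ _).
have [rk1 Zk1 _] := constK (k + K).+1 (leqW (leq_addl _ _)).
apply: le_trans (multiplier_step_bound _ Zk Zk1).
by rewrite -feasibility_gap rk1 mulrC mulrA.
Qed.

End LagrangianSequence.

(* Index 0 is avoided because the optimality conditions hold from index 1 on. *)
Lemma cluster_subsequence {R : realType} {V : normedModType R} (z : nat -> V) (l : V) :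
  cluster (z @ \oo) l -> exists2 phi : nat -> nat,
    {homo phi : i j / (i < j)%N} & z (phi k).+1 @[k --> \oo] --> l.
Proof.
(* The pair carries the precision rank and the previously chosen index. *)
move=> zl; have next (kN : nat * nat) :
    exists j, (kN.2 < j)%N /\ `|z j.+1 - l| < kN.1.+1%:R^-1.
  have k0 : (0 : R) < kN.1.+1%:R^-1 by rewrite invr_gt0.
  have tail : (z @ \oo) [set z j.+1 | j in [set j | (kN.2 < j)%N]].
    by exists kN.2.+2 => // -[//|j] /= Nj; exists j.
  have [_ [[j Nj <-] lj]] := zl _ _ tail (nbhsx_ballx l _ k0).
  by exists j; split=> //; move: lj; rewrite -ball_normE /ball_/= distrC.
have [f fP] := choice next.
pose phi := fix phi k := if k is k'.+1 then f (k, phi k') else f (0%N, 0%N).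
exists phi.
- by apply: homo_ltn => [|k]; [exact: ltn_trans|have [] := fP (k.+1, phi k)].
- apply: (@cvg_within_natSinv _ _ _ (cst l)); last exact: cvg_cst.
  by case=> [|k]; [have [] := fP (0%N, 0%N)|have [] := fP (k.+1, phi k)].
Qed.

(** Lower semicontinuity bounds the values from below and the upper limit from above; the upper
    bound, with [-oo] excluded, makes them eventually finite. *)
Lemma cvg_of_lsc_limn_esup {R : realType} {V : normedModType R} (h : V -> \bar R)
    (us : nat -> V) (u : V) :
  lower_semicontinuous h -> (forall w, h w != -oo%E) -> h u \is a fin_num ->
  us @ \oo --> u -> (limn_esup (h \o us) <= h u)%E -> (h \o us) @ \oo --> h u.
Proof.
move=> lsc hN hu usu sup_le.
have below (e : R) : 0 < e -> \forall k \near \oo, ((fine (h u) - e)%:E < h (us k))%E.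
  move=> e0; have [|W uW hW] := lsc u (fine (h u) - e).
    by rewrite -[ltRHS](fineK hu) lte_fin gtrBl.
  have : \forall k \near \oo, W (us k) := usu _ uW.
  by apply: filterS => k /hW.
have above (e : R) : 0 < e -> \forall k \near \oo, (h (us k) < (fine (h u) + e)%:E)%E.
  move=> e0; have : (limn_esup (h \o us) < (fine (h u) + e)%:E)%E.
    by apply: le_lt_trans sup_le _; rewrite -[ltLHS](fineK hu) lte_fin ltrDl.
  rewrite /limn_esup limf_esupE => /ereal_inf_lt[_ [B ooB <-]] supB.
  apply: filterS ooB => k Bk; apply: le_lt_trans supB.
  by apply: ereal_sup_ubound; exists k.
have fin : \forall k \near \oo, h (us k) \is a fin_num.
  apply: filterS (above 1 ltr01) => k hk; rewrite fin_numE hN/= -ltey.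
  by apply: lt_trans hk _; rewrite ltry.
rewrite -(fineK hu); apply/fine_cvgP; split=> //.
apply/cvgrPdist_le => e e0; apply: filterS3 fin (below e e0) (above e e0) => k hk.
rewrite -(fineK hk) !lte_fin => lo up.
by rewrite /= ler_norml; lra.
Qed.

(** * Passage to the limit in both optimality conditions *)

Theorem theorem3p1 (R : realType) (n m : nat) (hmn : (m <= n)%N)
    (f0 : 'rV[R]_n -> R) (F : 'rV[R]_n -> 'rV[R]_m) (h : 'rV[R]_m -> \bar R)
    (f0_diff : forall x, differentiable f0 x)
    (f0_C1 : continuous (grad f0))
    (F_diff : forall x, differentiable F x)
    (F_C1 : continuous (nabla F))
    (h_ninfty : forall u, h u != -oo%E)
    (h_lsc : lower_semicontinuous h)
    (dom_nonempty : dom h !=set0)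
    (dom_closed : closed (dom h))
    (h_well_posed : well_posed f0 F h)
    (h_cq : constraint_qualification F h)
    (Z : set 'rV[R]_n) (hZ : information_zone F h Z)
    (gamma LF Lf0 : R) (gamma_gt0 : 0 < gamma)
    (LF_ge0 : 0 <= LF) (Lf0_ge0 : 0 <= Lf0)
    (h_regular : regular_on_zone f0 F Z gamma LF Lf0)
    (a b delta tau : R) (a_gt0 : 0 < a) (b_gt0 : 0 < b)
    (delta_gt0 : 0 < delta) (tau_gt0 : 0 < tau) (tau_lt : tau < a / 2)
    (A : R -> 'rV[R]_n -> 'rV[R]_m -> 'rV[R]_m -> set ('rV[R]_n * 'rV[R]_m))
    (xm1 : 'rV[R]_n) (x : nat -> 'rV[R]_n) (u y : nat -> 'rV[R]_m)
    (rho : nat -> R) (rho0_gt0 : 0 < rho 0%N)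
    (z_lagrangian :
       lagrangian_sequence f0 F h Z gamma a b delta tau A xm1 x u y rho)
    (z_bounded : bounded_set (range (fun k => (x k, u k, y k))))
    (xbar : 'rV[R]_n) (ubar ybar : 'rV[R]_m)
    (z_cluster :
       cluster ((fun k => (x k, u k, y k)) @ \oo) (xbar, ubar, ybar)) :
  crit f0 F h xbar.
Proof.
have [M yM] : exists M, forall k, enorm (y k) <= M.
  have [B _ zB] := ex_strict_bound_gt0 z_bounded.
  exists (m.+1%:R * B) => k; apply: le_trans (enorm_le_norm _) _.
  rewrite ler_wpM2l//; apply: le_trans (ltW (zB _ (ex_intro2 _ _ k I erefl))).
  by rewrite /= prod_normE le_max lexx orbT.
have step0 := step_cvg0 f0_diff F_diff h_well_posed hZ h_regular gamma_gt0 LF_ge0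
  Lf0_ge0 b_gt0 delta_gt0 tau_gt0 tau_lt rho0_gt0 z_lagrangian yM.
have gap0 := gap_cvg0 f0_diff F_diff h_well_posed hZ h_regular gamma_gt0 LF_ge0
  Lf0_ge0 b_gt0 delta_gt0 tau_gt0 tau_lt rho0_gt0 z_lagrangian yM.
have [phi phi_incr zphi] := cluster_subsequence _ _ z_cluster.
have phi_oo : phi @ \oo --> \oo.
  apply/cvgnyPge => N; exists N => // k /= Nk; apply: leq_trans Nk _.
  by elim: k => // k IH; exact: leq_ltn_trans IH (phi_incr _ _ (ltnSn k)).
have xuphi : (x (phi k).+1, u (phi k).+1) @[k --> \oo] --> (xbar, ubar).
  exact: (cvg_comp _ _ zphi cvg_fst).
have yphi : y (phi k).+1 @[k --> \oo] --> ybar.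
  exact: (cvg_comp _ _ zphi cvg_snd).
have xphi : x (phi k).+1 @[k --> \oo] --> xbar.
  exact: (cvg_comp _ _ xuphi cvg_fst).
have uphi : u (phi k).+1 @[k --> \oo] --> ubar.
  exact: (cvg_comp _ _ xuphi cvg_snd).
have [_ _ _ _ C4] := z_lagrangian.
have FxE : F xbar = ubar.
  have Fphi : F (x (phi k).+1) - u (phi k).+1 @[k --> \oo] --> F xbar - ubar.
    apply: cvgB => //.
    exact: (cvg_comp _ _ xphi (differentiable_continuous (F_diff xbar))).
  apply/eqP; rewrite -subr_eq0; apply/eqP.
  exact: (cvg_unique _ Fphi (cvg_comp _ _ phi_oo gap0)).
have hfin k : h (u k.+1) \is a fin_num := h_fin_num delta_gt0 rho0_gt0 z_lagrangian k.
(* Closedness of [dom h] carries finiteness from the iterates to the limit. *)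
have hubar : h ubar \is a fin_num.
  rewrite fin_numE h_ninfty/= -ltey; apply: (closed_cvg _ dom_closed _ _ uphi).
  by apply: nearW => k; rewrite /dom/= ltey_eq hfin.
have huphi : h (u (phi k).+1) @[k --> \oo] --> h ubar.
  apply: (cvg_of_lsc_limn_esup h (fun k => u (phi k).+1)) => //.
  exact: (C4 (fun k => (phi k).+1)).
have [c c0 sub] := multiplier_subdiff delta_gt0 rho0_gt0 z_lagrangian.
have {}sub k : exists w, limiting_subdiff h (u k.+1) (w + y k.+1) /\
    enorm w <= c * enorm (x k.+1 - x k) by have [w] := sub k; exists w.
(* [w k] is the error by which [y k.+1] misses being a subgradient; it vanishes with the primal
   step. *)
have [w wP] := choice sub.
have w0 : w k @[k --> \oo] --> (0 : 'rV[R]_m).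
  apply: cvg_enorm0; apply: squeeze_cvgr (cvg_cst (0 : R)) _.
    by apply: nearW => k; rewrite enorm_ge0; have [_] := wP k; exact.
  by rewrite -(mulr0 c); apply: cvgM step0; exact: cvg_cst.
exists ybar.
  rewrite FxE; apply: (@limiting_subdiff_closed _ _ _ _ _ (fun k => u (phi k).+1)
    (fun k => w (phi k) + y (phi k).+1)) => //.
    by move=> k; have [] := wP (phi k).
  rewrite -[ybar]add0r; apply: cvgD => //.
  exact: (cvg_comp _ _ phi_oo w0).
(* The residual tends to 0 along the whole sequence and, by continuity, to its value at the cluster
   point along [phi]; uniqueness of limits equates the two. *)
have grad0 : grad f0 (x k.+1) + y k.+1 *m nabla F (x k.+1) @[k --> \oo] -->
    (0 : 'rV[R]_n).
  apply: cvg_enorm0; apply: squeeze_cvgr (cvg_cst (0 : R)) _.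
    by apply: nearW => k; rewrite enorm_ge0;
      exact: gradient_bound f0_diff F_diff z_lagrangian k.
  by rewrite -(mulr0 b); apply: cvgM step0; exact: cvg_cst.
have gradphi : grad f0 (x (phi k).+1) + y (phi k).+1 *m nabla F (x (phi k).+1)
    @[k --> \oo] --> grad f0 xbar + ybar *m nabla F xbar.
  apply: cvgD; first exact: (cvg_comp _ _ xphi (f0_C1 xbar)).
  by apply: cvg_mulmx => //; exact: (cvg_comp _ _ xphi (F_C1 xbar)).
exact: (cvg_unique _ (cvg_comp _ _ phi_oo grad0) gradphi).
Qed.
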